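(* For $\ell\ge1$, let $\mathscr{A}$ be the toric arrangement in $(\mathbb{S}^1)^\ell$ consisting of the hypertori $\{t_i=1\}$ ($1\le i\le\ell$), $\{t_it_j=1\}$ and $\{t_it_j^{-1}=1\}$ ($1\le i<j\le\ell$) (the arrangement of $\Phi^+(B_\ell)$ with respect to the integer lattice). Then $\mathscr{A}$ is supersolvable if and only if $\ell\le2$.
   Context: The poset of layers $L(\mathscr{A})$ consists of connected components of nonempty intersections of subsets of $\mathscr{A}$ (empty intersection $=(\mathbb{S}^1)^\ell$), ordered by reverse inclusion, with rank $=$ codimension; $\mathscr{A}$ is supersolvable if $L(\mathscr{A})$ is. For a finite ranked poset $\mathcal{P}$ with minimum $\hat0$ in which each $\mathcal{P}_{\le x}$ is a geometric lattice (a lattice where $y$ covers $x$ iff $y=x\vee a$ for some atom $a\not\le x$): $\bigvee T$ denotes the set of minimal upper bounds of $T$; an element $y$ of a geometric lattice $L$ is modular if $y\wedge(w\vee z)=(y\wedge w)\vee z$ for all $z\le y$, $w\in L$; an M-ideal of $\mathcal{P}$ is a pure (all maximal elements of equal rank), join-closed ($T\subseteq\mathcal{Q}\Rightarrow\bigvee T\subseteq\mathcal{Q}$) order ideal $\mathcal{Q}$ such that (1) every atom $a\notin\mathcal{Q}$ and $y\in\mathcal{Q}$ have at least one minimal upper bound, and (2) for every maximal $x\in\mathcal{P}$ some maximal $y\in\mathcal{Q}$ is modular in $\mathcal{P}_{\le x}$; $\mathcal{P}$ is supersolvable if there is a chain $\{\hat0\}=\mathcal{Q}_0\subsetneq\mathcal{Q}_1\subsetneq\cdots\subsetneq\mathcal{Q}_r=\mathcal{P}$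 with each $\mathcal{Q}_i$ an M-ideal of $\mathcal{Q}_{i+1}$ and $\operatorname{rk}(\mathcal{Q}_i)=i$. *)

(* Defs.v *)
From HB Require Import structures.
From mathcomp Require Import all_boot all_order all_algebra.
From mathcomp Require Import all_classical all_reals all_analysis.
Set Implicit Arguments. Unset Strict Implicit. Unset Printing Implicit Defensive.
Import Order.TTheory GRing.Theory Num.Theory.
Import numFieldNormedType.Exports.
Local Open Scope classical_set_scope.
Local Open Scope ring_scope.

Section PosetDefs.
Variables (T : Type) (le : T -> T -> Prop).

Definition plt (x y : T) : Prop := le x y /\ x <> y.

Definition rank_in (P : set T) (x : T) (n : nat) : Prop :=
  P x /\
  (exists c : nat -> T, (forall i, (i <= n)%N -> P (c i)) /\
      (forall i, (i < n)%N -> plt (c i) (c i.+1)) /\ c n = x) /\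
  (forall (m : nat) (c : nat -> T), (forall i, (i <= m)%N -> P (c i)) ->
      (forall i, (i < m)%N -> plt (c i) (c i.+1)) -> c m = x -> (m <= n)%N).

Definition rank_of_set (Q : set T) (i : nat) : Prop :=
  (exists x, Q x /\ rank_in Q x i) /\
  (forall x n, Q x -> rank_in Q x n -> (n <= i)%N).

Definition is_bottom (P : set T) (b : T) : Prop := P b /\ forall x, P x -> le b x.

Definition maximal_in (Q : set T) (x : T) : Prop :=
  Q x /\ forall y, Q y -> le x y -> y = x.

Definition atom_of (P : set T) (a : T) : Prop :=
  P a /\ exists b, is_bottom P b /\ plt b a /\
    forall y, P y -> le b y -> le y a -> y = b \/ y = a.

Definition mub (P : set T) (S : set T) (u : T) : Prop :=
  P u /\ (forall s, S s -> le s u) /\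
  forall v, P v -> (forall s, S s -> le s v) -> le v u -> v = u.

Definition order_ideal (P Q : set T) : Prop :=
  Q `<=` P /\ forall x y, Q x -> P y -> le y x -> Q y.

Definition pure (Q : set T) : Prop :=
  forall x y n m, maximal_in Q x -> maximal_in Q y ->
    rank_in Q x n -> rank_in Q y m -> n = m.

Definition join_closed (P Q : set T) : Prop :=
  forall S, S `<=` Q -> mub P S `<=` Q.

Definition is_lub (L : set T) (a b j : T) : Prop :=
  L j /\ le a j /\ le b j /\ forall u, L u -> le a u -> le b u -> le j u.
Definition is_glb (L : set T) (a b m : T) : Prop :=
  L m /\ le m a /\ le m b /\ forall u, L u -> le u a -> le u b -> le u m.

Definition lower_interval (P : set T) (x : T) : set T :=
  [set u | P u /\ le u x].

Definition modular_in (L : set T) (y : T) : Prop :=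
  L y /\ forall w z, L w -> L z -> le z y ->
    forall j m m' j', is_lub L w z j -> is_glb L y j m ->
      is_glb L y w m' -> is_lub L m' z j' -> m = j'.

Definition M_ideal (P Q : set T) : Prop :=
  pure Q /\ join_closed P Q /\ order_ideal P Q /\
  (forall a y, atom_of P a -> ~ Q a -> Q y -> exists u, mub P [set a; y] u) /\
  (forall x, maximal_in P x -> exists y, maximal_in Q y /\ le y x /\
        modular_in (lower_interval P x) y).

Definition supersolvable_poset (P : set T) : Prop :=
  exists (r : nat) (Q : nat -> set T),
    (exists b, is_bottom P b /\ Q 0%N = [set b]) /\
    Q r = P /\
    (forall i, (i < r)%N -> Q i `<=` Q i.+1 /\ Q i <> Q i.+1 /\
                           M_ideal (Q i.+1) (Q i)) /\
    (forall i, (i <= r)%N -> rank_of_set (Q i) i).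

End PosetDefs.

Section Torus.
Variables (R : realType) (l : nat).

Definition pt := ('rV[R]_l * 'rV[R]_l)%type.

Definition coord (t : pt) (k : 'I_l) : R * R := (t.1 0 k, t.2 0 k).

Definition cmul (u v : R * R) : R * R :=
  (u.1 * v.1 - u.2 * v.2, u.1 * v.2 + u.2 * v.1).
Definition cinv (u : R * R) : R * R :=
  (u.1 / (u.1 ^+ 2 + u.2 ^+ 2), - u.2 / (u.1 ^+ 2 + u.2 ^+ 2)).
Definition cone : R * R := (1, 0).

Definition torus : set pt :=
  [set t | forall k, (coord t k).1 ^+ 2 + (coord t k).2 ^+ 2 = 1].

(* index type of the arrangement of Phi^+(B_l):
   inl i        <-> {t_i = 1}
   inr (i,j,true)  <-> {t_i t_j = 1}        (i < j)
   inr (i,j,false) <-> {t_i t_j^{-1} = 1}   (i < j) *)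
Definition idx := ('I_l + ({p : 'I_l * 'I_l | (p.1 < p.2)%N} * bool))%type.

Definition hyp (h : idx) : set pt :=
  match h with
  | inl i => [set t | torus t /\ coord t i = cone]
  | inr (p, true) =>
      [set t | torus t /\ cmul (coord t (val p).1) (coord t (val p).2) = cone]
  | inr (p, false) =>
      [set t | torus t /\
         cmul (coord t (val p).1) (cinv (coord t (val p).2)) = cone]
  end.

(* intersection of the subfamily F (empty intersection = whole torus) *)
Definition inter (F : {set idx}) : set pt :=
  [set t | torus t /\ forall h, h \in F -> hyp h t].

Definition layers : set (set pt) :=
  [set C | exists (F : {set idx}) (x : pt),
             inter F x /\ C = connected_component (inter F) x].

Definition layer_le (C D : set pt) : Prop := D `<=` C.

Definition supersolvable_BL : Prop :=
  supersolvable_poset layer_le layers.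

End Torus.

(* Main.v *)
(* Let Q be the last proper M-ideal of a supersolvable chain.  If a maximal
   element y of Q is modular below the point x, then every layer w of
   codimension two through x lies with y in a common hypertorus: otherwise
   z |-> w \/ z is injective on the layers containing y, and produces too long
   a chain.  For x = (-1, .., -1) and w = {t_i = t_j = -1}, this forces
   y = {(u^e_1, .., u^e_l)} for some signs e_k, so that y also passes through
   (1, .., 1).  As Q is join-closed but does not contain (1, .., 1), y is the
   only maximal element of Q through (1, .., 1), hence modular there; but for
   l >= 3 it shares no hypertorus with {t_1 = 1, t_2 = t_3^e} for one of the
   two signs e. *)
Require Import Defs.
From mathcomp Require Import all_boot all_order all_algebra ring lra.
From mathcomp Require Import all_classical all_reals all_analysis.
Set Implicit Arguments.
Unset Strict Implicit.
Unset Printing Implicit Defensive.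
Import Order.TTheory GRing.Theory Num.Theory.
Import numFieldNormedType.Exports.
Local Open Scope classical_set_scope.
Local Open Scope ring_scope.

(** * Chains and M-ideals in finite posets *)

Section FinitePosets.
Variables (T : Type) (le : T -> T -> Prop) (P : set T).

Definition strict_chain (c : nat -> T) (m : nat) : Prop :=
  (forall i, (i <= m)%N -> P (c i)) /\
  (forall i, (i < m)%N -> plt le (c i) (c i.+1)).

Lemma rank_in_unique (Q : set T) x n m : rank_in le Q x n -> rank_in le Q x m -> n = m.
Proof.
move=> [_ [[c [cP [cl cx]]] cm]] [_ [[d [dP [dl dx]]] dm]].
by apply/eqP; rewrite eqn_leq (dm _ _ cP cl cx) (cm _ _ dP dl dx).
Qed.

Lemma rank_in_ge x n c m :
  rank_in le P x n -> strict_chain c m -> c m = x -> (m <= n)%N.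
Proof. by move=> [_ [_ h]] [cP cl]; exact: h. Qed.

Lemma rank_exists N x :
  (forall c m, strict_chain c m -> (m <= N)%N) -> P x ->
  exists n, rank_in le P x n.
Proof.
move=> bnd Px.
pose p m := `[< exists c, strict_chain c m /\ c m = x >].
have p0 : exists m, p m by exists 0; apply/asboolP; exists (fun=> x).
have pN m : p m -> (m <= N)%N by move=> /asboolP[c [/bnd]].
case: (ex_maxnP p0 pN) => n /asboolP[c [[cP cl] cx]] nmax.
exists n; split=> //; split; first by exists c.
by move=> m d dP dl dx; apply: nmax; apply/asboolP; exists d.
Qed.

Hypothesis lexx : forall x, le x x.
Hypothesis le_trans : forall y x z, le x y -> le y z -> le x z.
Hypothesis le_anti : forall x y, le x y -> le y x -> x = y.

Lemma strict_chain_le c m i j :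
  strict_chain c m -> (i <= j <= m)%N -> le (c i) (c j).
Proof.
move=> [_ cl] /andP[]; elim: j => [|j IH].
  by rewrite leqn0 => /eqP -> _.
rewrite leq_eqVlt ltnS => /orP[/eqP-> //|ij jm].
by apply: le_trans (IH ij (ltnW jm)) _; have [] := cl _ jm.
Qed.

(** For [z = b] both sides of the modular law are the meet of [y] and [w]; for [z = y] both are [y].
    The case [y = b] is allowed and serves [M_ideal_bottom]. *)
Lemma atom_modular b y (L : set T) : is_bottom le L b -> L y ->
  (forall z, L z -> le z y -> z = b \/ z = y) -> modular_in le L y.
Proof.
move=> [Lb bmin] Ly yatom; split=> // w z Lw Lz zy j m m' j'
  [Lj [wj [zj jmin]]] [Lm [my [mj mmax]]] [Lm' [m'y [m'w m'max]]] [Lj' [m'j' [zj' j'min]]].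
have [zb|zE] := yatom z Lz zy; subst z.
  have jw : j = w by apply: le_anti => //; apply: jmin => //; exact: bmin.
  subst j; have -> : m = m'.
    by apply: le_anti; [exact: m'max | exact: mmax].
  by apply: le_anti => //; apply: j'min => //; exact: bmin.
have -> : m = y by apply: le_anti => //; exact: mmax.
by apply: le_anti => //; exact: j'min.
Qed.

Lemma M_ideal_bottom b : is_bottom le P b -> M_ideal le P [set b].
Proof.
move=> [Pb bmin]; split; [|split; [|split; [|split]]].
- by move=> x y n m [-> _] [-> _]; exact: rank_in_unique.
- move=> S SQ u [Pu [_ umin]]; apply/esym/umin => //; last exact: bmin.
  by move=> s /SQ ->.
- split; first by move=> x ->.
  by move=> x y -> Py /le_anti; apply; exact: bmin.
- move=> a y [Pa _] _ ->; exists a; split=> //; split.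
    by move=> s [->|->] //; exact: bmin.
  by move=> v Pv va le_va; apply: le_anti => //; apply: va; left.
- move=> x [Px _]; exists b; split; last split.
  + by split=> // y ->.
  + exact: bmin.
  + apply: (@atom_modular b).
    * by split=> [|z [Pz _]]; [split=> //|]; exact: bmin.
    * by split=> //; exact: bmin.
    * by move=> z [Pz _] zb; left; apply: le_anti => //; exact: bmin.
Qed.

(** The penultimate ideal of the chain, with ranks turned into chain lengths; purity is what lets
    every maximal element of [Q] end a chain of length [r]. *)
Lemma supersolvable_coatoms N : (forall c m, strict_chain c m -> (m <= N)%N) ->
  (forall b, P <> [set b]) -> supersolvable_poset le P ->
  exists (r : nat) (Q : set T), [/\ M_ideal le P Q, Q <> P,
    (forall c m, strict_chain c m -> (m <= r.+1)%N) &
    (forall y, maximal_in le Q y -> exists c, strict_chain c r /\ c r = y)].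
Proof.
move=> bnd Pn1 [[|r] [Q [[b [_ Q0]] [QP [QM Qrk]]]]].
  by case: (Pn1 b); rewrite -QP.
have [QrP [Qneq M]] := QM r (leqnn _); rewrite QP in M Qneq QrP.
exists r, (Q r); split=> //.
  move=> c m cm; have [n rkn] := rank_exists bnd (proj1 cm m (leqnn m)).
  apply: leq_trans (rank_in_ge rkn cm erefl) _.
  have [_] := Qrk r.+1 (leqnn _); rewrite QP => /(_ _ _ _ rkn); apply.
  by case: rkn.
have [[x0 [Qx0 rk0]] rkmax] := Qrk r (leqnSn r).
(* A chain whose top lies in the order ideal [Q r] stays in it, so ranks in [Q r] and in [P]
   agree. *)
have rkQ x : Q r x -> exists n, rank_in le (Q r) x n.
  move=> Qx; have [n [_ [[c [cP [cl cx]]] cmax]]] := rank_exists bnd (QrP _ Qx).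
  exists n; split=> //; split.
    exists c; split=> // i ilen; have [_ [_ [[_ oi] _]]] := M.
    apply: (oi x) => //; first exact: cP.
    by rewrite -cx; apply: (@strict_chain_le c n); rewrite ?ilen /=.
  by move=> m d dQ; apply: cmax => i /dQ /QrP.
(* A larger [y] in [Q r] would prolong a chain of length [r] ending at [x0]. *)
have x0max : maximal_in le (Q r) x0.
  split=> // y Qy x0y; apply: contrapT => yx0.
  have [n rkn] := rkQ y Qy; have := rkmax y n Qy rkn.
  have [_ [[c [cP [cl cx]]] _]] := rk0; have [_ [_ nmax]] := rkn.
  suff : (r.+1 <= n)%N by move=> h /(leq_trans h); rewrite ltnn.
  apply: (nmax r.+1 (fun i => if (i <= r)%N then c i else y)) => [i _|i|] /=.
  - by case: ifP => // /cP.
  - rewrite ltnS => ir; rewrite ir; case: ltnP => [|ri]; first exact: cl.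
    have -> : i = r by apply/eqP; rewrite eqn_leq ir.
    by rewrite cx; split=> // /esym.
  - by rewrite ltnn.
move=> y ymax; have [n rkn] := rkQ y (proj1 ymax).
have [pur _] := M; have rn := pur _ _ _ _ x0max ymax rk0 rkn; subst n.
have [_ [[c [cP [cl cx]]] _]] := rkn; exists c; split=> //; split=> // i /cP.
exact: QrP.
Qed.

(* If [y] misses the rank-two element [w], modularity makes [z |-> w \/ z]
   injective below [y], and the image of a maximal chain below [y], preceded by
   [b < a], is too long. *)
Lemma modular_meets_rank2 r x y b a w c :
  (forall d m, strict_chain d m -> (m <= r.+1)%N) ->
  let L := lower_interval le P x in
  (forall u v, L u -> L v -> exists j, is_lub le L u v j) ->
  (forall u v, L u -> L v -> exists j, is_glb le L u v j) ->
  modular_in le L y -> strict_chain c r -> c r = y -> is_bottom le P b ->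
  L a -> L w -> plt le b a -> plt le a w -> ~ is_glb le L y w b.
Proof.
move=> bnd L lubs glbs [Ly ymod] cr cy [Pb bmin] La Lw ba aw ywb.
have Lb : L b by split=> //; case: La => Pa; apply: le_trans; exact: bmin.
have cyle i : (i <= r)%N -> le (c i) y.
  by move=> ir; rewrite -cy; apply: strict_chain_le cr _; rewrite ir /=.
have Lc i : (i <= r)%N -> L (c i).
  move=> ir; split; first exact: (proj1 cr).
  by apply: le_trans (cyle _ ir) _; case: Ly.
have /choice[J JE] : forall i, exists j, (i <= r)%N -> is_lub le L w (c i) j.
  move=> i.
  have [ir|ri] := leqP i r; last by exists b.
  by have [j hj] := lubs _ _ Lw (Lc i ir); exists j.
(* The modular law for [z = c i], with [b] as the meet of [y] and [w], recovers [c i] from [J i]. *)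
have glbJ i : (i <= r)%N -> is_glb le L y (J i) (c i).
  move=> ir; have LJ : L (J i) by case: (JE i ir).
  have [m hm] := glbs _ _ Ly LJ.
  suff <- : m = c i by [].
  apply: (ymod w (c i) Lw (Lc i ir) (cyle i ir) (J i) m b (c i)) => //.
    exact: JE.
  by split; [exact: Lc|split; [exact: bmin (proj1 (Lc i ir))|split]].
pose d i := if i is i'.+1 then (if i' is k.+1 then J k else a) else b.
suff /bnd : strict_chain d r.+2 by rewrite ltnn.
split=> [[|[|i]]|[|[|i]]] /=.
- by [].
- by case: La.
- by rewrite !ltnS => /JE [[]].
- by [].
- move=> _; have [_ [wJ _]] := JE 0 (leq0n r); split.
    by apply: le_trans (proj1 aw) wJ.
  by move=> aJ; case: aw => aw; apply; apply: le_anti => //; rewrite aJ.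
- rewrite !ltnS => ir; have [[cP cl] irW] := (cr, ltnW ir).
  have [cc cn] := cl _ ir.
  have [_ [_ [_ Jmin]]] := JE i irW; have [LJ [wJ [cJ _]]] := JE i.+1 ir.
  split; first by apply: Jmin => //; apply: le_trans cc cJ.
  move=> JJ; apply: cn.
  have [_ [_ [_ m1]]] := glbJ i irW; have [_ [_ [_ m2]]] := glbJ i.+1 ir.
  apply: le_anti => //; apply: m1; [exact: Lc|exact: cyle|by rewrite JJ].
Qed.

End FinitePosets.

(** * Ranks and M-ideals with at most two elements *)

Section LowRank.
Variables (T : Type) (le : T -> T -> Prop) (P : set T).
Hypothesis lexx : forall x, le x x.
Hypothesis le_anti : forall x y, le x y -> le y x -> x = y.

Lemma rank_of_set_chain (Q : set T) i c :
  strict_chain le Q c i -> (forall d m, strict_chain le Q d m -> (m <= i)%N) ->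
  rank_of_set le Q i.
Proof.
move=> [cQ cl] bnd; split.
  exists (c i); split; first exact: cQ.
  split; first exact: cQ.
  split; first by exists c.
  by move=> m d dQ dl _; apply: (bnd d).
by move=> x n Qx [_ [[d [dQ [dl _]]] _]]; apply: (bnd d).
Qed.

Lemma plt_neq_bottom b x y : is_bottom le P b -> P x -> plt le x y -> y <> b.
Proof.
by move=> [_ bmin] Px [xy nxy] yb; apply: nxy; apply: le_anti => //;
  rewrite yb; exact: bmin.
Qed.

Lemma rank_of_set1 (b : T) : rank_of_set le [set b] 0.
Proof.
apply: (@rank_of_set_chain _ _ (fun=> b)) => [|d [//|m] [dQ dl]].
  by split.
have := dQ 0 isT; have := dQ 1 isT; have [_] := dl 0 isT.
by move=> /= n1 e1 e0; case: n1; rewrite e0 e1.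
Qed.

Lemma rank_of_set2 b h : is_bottom le P b -> P h -> plt le b h ->
  rank_of_set le [set b; h] 1.
Proof.
move=> bb Ph bh; have [Pb bmin] := bb.
apply: (@rank_of_set_chain _ _ (fun i => if i is 0 then b else h)).
  by split=> [[|i] _|[|i]] //=; [left|right].
move=> d [|[|m]] // [dQ dl]; exfalso.
have dh i : (i < m.+2)%N -> d i.+1 = h.
  move=> im; case: (dQ i.+1 im) => // db.
  have Pd : P (d i) by case: (dQ i (ltnW im)) => ->.
  by case: (plt_neq_bottom bb Pd (dl i im)).
by have [_] := dl 1 isT; rewrite !dh.
Qed.

(** Modularity of [h] below every maximal element comes from [atom_modular]; condition (1) is
    automatic for the bottom and is assumed for [h]. *)
Lemma M_ideal_atom b h : is_bottom le P b -> P h -> b <> h ->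
  (forall z, P z -> le z h -> z = b \/ z = h) ->
  (forall a, atom_of le P a -> exists u, mub le P [set a; h] u) ->
  (forall x, maximal_in le P x -> le h x) ->
  M_ideal le P [set b; h].
Proof.
move=> [Pb bmin] Ph bh hatom amub hmax.
have bleh : le b h by exact: bmin.
have QP : [set b; h] `<=` P by move=> _ [->|->].
have hmx : maximal_in le [set b; h] h.
  by split=> [|y [->|->] // hb]; [right|apply: le_anti].
have maxh x : maximal_in le [set b; h] x -> x = h.
  move=> [[-> xm|-> //]]; apply/esym/xm => //; by right.
split; [|split; [|split; [|split]]].
- move=> x y n m /maxh -> /maxh ->; exact: rank_in_unique.
(* If [S] contains [h], then [h] bounds [S] and lies below [u], so [u = h]; otherwise [b] bounds [S]
   and [u = b]. *)
- move=> S SQ u [Pu [uub umin]]; have [Sh|nSh] := pselect (S h).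
    right; apply/esym/umin => //; last exact: uub.
    by move=> s /SQ[->|->].
  left; apply/esym/umin => //; last exact: bmin.
  by move=> s Ss; case: (SQ s Ss) => [->|sh] //; case: nSh; rewrite -sh.
- split=> // x y [->|->] Py yx; last by case: (hatom y Py yx) => ->; [left|right].
  by left; apply: le_anti => //; exact: bmin.
- move=> a y aat _ [->|->]; last exact: amub.
  have [Pa _] := aat; exists a; split=> //; split.
    by move=> s [->|->] //; exact: bmin.
  by move=> v Pv va le_va; apply: le_anti => //; apply: va; left.
- move=> x xmax; exists h; split=> //; split; first exact: hmax.
  have [Px _] := xmax.
  apply: (atom_modular lexx le_anti (b := b)).
  + by split=> [|z [Pz _]]; [split=> //|]; exact: bmin.
  + by split=> //; exact: hmax.
  + by move=> z [Pz _]; exact: hatom.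
Qed.

End LowRank.

(** * The poset of layers *)

Section Layers.
Variables (R : realType) (l : nat).
Implicit Types (C D E : set (pt R l)) (p : pt R l) (F G : {set idx l}).

Definition layer_at F p : set (pt R l) := connected_component (@inter R l F) p.

(** Together with one point, the carrier determines the layer ([layerE]), so order and lattice
    operations at a point reduce to those on finite sets. *)
Definition carrier C : {set idx l} := [set h | `[< C `<=` @hyp R l h >]]%SET.

Lemma carrierP C h : reflect (C `<=` @hyp R l h) (h \in carrier C).
Proof. by rewrite inE; apply: asboolP. Qed.

Lemma carrierS C D : D `<=` C -> carrier C \subset carrier D.
Proof.
by move=> DC; apply/fintype.subsetP => h /carrierP Ch; apply/carrierP => t /DC/Ch.
Qed.

Lemma interS F G : F \subset G -> @inter R l G `<=` @inter R l F.
Proof. by move=> /fintype.subsetP FG t [tt th]; split=> // h /FG /th. Qed.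

Lemma inter_carrier C : @layers R l C -> C `<=` @inter R l (carrier C).
Proof.
move=> [F [x [Fx ->]]] t Ct; split.
  by have [] := connected_component_sub Ct.
by move=> h /carrierP; apply.
Qed.

Lemma sub_carrier_layer_at F p : F \subset carrier (layer_at F p).
Proof.
apply/fintype.subsetP => h hF; apply/carrierP => t /connected_component_sub[_].
exact.
Qed.

Lemma layer_connected C : @layers R l C -> connected C.
Proof. by move=> [F [x [Fx ->]]]; exact: component_connected. Qed.

Lemma layer_nonempty C : @layers R l C -> C !=set0.
Proof.
by move=> [F [x [Fx ->]]]; exists x; exact: connected_component_refl.
Qed.

Lemma layers_layer_at F p : @inter R l F p -> @layers R l (layer_at F p).
Proof. by move=> Fp; exists F, p. Qed.

Lemma layer_at_self F p : @inter R l F p -> layer_at F p p.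
Proof. exact: connected_component_refl. Qed.

Lemma layer_at_max C p F : C p -> connected C -> C `<=` @inter R l F -> C `<=` layer_at F p.
Proof. by move=> Cp Cc CF; exact: connected_component_max. Qed.

Lemma layer_sub_layer_at C p F :
  @layers R l C -> C p -> F \subset carrier C -> C `<=` layer_at F p.
Proof.
move=> LC Cp FC; apply: layer_at_max => //; first exact: layer_connected.
by move=> t /(inter_carrier LC) /(interS FC).
Qed.

(** A layer may be presented by an [F] smaller than its carrier; the additional hypertori contain
    the whole component and cut nothing off. *)
Lemma layerE C p : @layers R l C -> C p -> C = layer_at (carrier C) p.
Proof.
move=> LC Cp; apply/seteqP; split; first exact: layer_sub_layer_at.
move: LC Cp => [F [x [Fx ->]]] xp;
  rewrite [X in _ `<=` X](same_connected_component xp).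
apply: layer_at_max; [|exact: component_connected|].
  by apply: layer_at_self; apply: inter_carrier xp; exists F, x.
by move=> t /connected_component_sub; apply/interS/sub_carrier_layer_at.
Qed.

Lemma layer_at_sub_layer C p F :
  @layers R l C -> C p -> carrier C \subset F -> layer_at F p `<=` C.
Proof.
move=> LC Cp CF; have [Fp|nFp] := pselect (@inter R l F p); last first.
  by rewrite /layer_at connected_component_out.
rewrite [X in _ `<=` X](layerE LC Cp).
apply: layer_at_max; [exact: layer_at_self|exact: component_connected|].
by move=> t /connected_component_sub /(interS CF).
Qed.

Lemma inter_setU C D p : @layers R l C -> @layers R l D -> C p -> D p ->
  @inter R l (carrier C :|: carrier D)%SET p.
Proof.
move=> LC LD Cp Dp; split; first by have [] := inter_carrier LC Cp.
by move=> h /setUP[/carrierP|/carrierP]; apply.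
Qed.

Lemma inter_setI C D p : @layers R l C -> C p ->
  @inter R l (carrier C :&: carrier D)%SET p.
Proof.
move=> LC Cp; apply: interS (inter_carrier LC Cp); exact: finset.subsetIl.
Qed.

(** The interval below [[set p]] consists of the layers through [p], and these are ordered by
    inclusion of their carriers. *)
Lemma layer_lub C D p : @layers R l C -> @layers R l D -> C p -> D p ->
  is_lub (@layer_le R l) (lower_interval (@layer_le R l) (@layers R l) [set p])
    C D (layer_at (carrier C :|: carrier D)%SET p).
Proof.
move=> LC LD Cp Dp; have Up := inter_setU LC LD Cp Dp.
split; first by split; [exact: layers_layer_at|move=> t ->; exact: layer_at_self].
split; first by apply: layer_at_sub_layer => //; exact: finset.subsetUl.
split; first by apply: layer_at_sub_layer => //; exact: finset.subsetUr.
move=> E [LE Ep] /carrierS CE /carrierS DE; apply: layer_sub_layer_at => //.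
  exact: Ep.
by rewrite finset.subUset CE.
Qed.

Lemma layer_glb C D p : @layers R l C -> @layers R l D -> C p -> D p ->
  is_glb (@layer_le R l) (lower_interval (@layer_le R l) (@layers R l) [set p])
    C D (layer_at (carrier C :&: carrier D)%SET p).
Proof.
move=> LC LD Cp Dp; have Ip := inter_setI D LC Cp.
split; first by split; [exact: layers_layer_at|move=> t ->; exact: layer_at_self].
split; first by apply: layer_sub_layer_at => //; exact: finset.subsetIl.
split; first by apply: layer_sub_layer_at => //; exact: finset.subsetIr.
move=> E [LE Ep] /carrierS CE /carrierS DE; apply: layer_at_sub_layer => //.
  exact: Ep.
by rewrite finset.subsetI CE.
Qed.

(** The competitors are now all layers; but an upper bound below the candidate contains it as a set,
    hence passes through [p]. *)
Lemma layer_mub C D p : @layers R l C -> @layers R l D -> C p -> D p ->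
  mub (@layer_le R l) (@layers R l) [set C; D]
    (layer_at (carrier C :|: carrier D)%SET p).
Proof.
move=> LC LD Cp Dp; have Up := inter_setU LC LD Cp Dp.
have [_ [UC [UD _]]] := layer_lub LC LD Cp Dp.
split; first exact: layers_layer_at.
split.
  move=> s [->|->] //.
move=> E LE ECD UE; apply/seteqP; split=> //.
apply: layer_sub_layer_at => //; first exact: UE (layer_at_self Up).
rewrite finset.subUset; apply/andP; split; apply: carrierS.
  exact: (ECD C (or_introl erefl)).
exact: (ECD D (or_intror erefl)).
Qed.

Lemma layer_le_anti C D : layer_le C D -> layer_le D C -> C = D.
Proof. by move=> CD DC; apply/seteqP; split. Qed.

Lemma layer_le_trans D C E : layer_le C D -> layer_le D E -> layer_le C E.
Proof. by move=> CD DE t /DE /CD. Qed.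

Lemma layer_lexx C : layer_le C C. Proof. by []. Qed.

Lemma carrier_proper C D : @layers R l C -> @layers R l D ->
  plt (@layer_le R l) C D -> carrier C \proper carrier D.
Proof.
move=> LC LD [DC nCD]; rewrite finset.properEneq carrierS // andbT.
apply/eqP => cCD; apply: nCD; have [p Dp] := layer_nonempty LD.
by rewrite (layerE LD Dp) (layerE LC (DC _ Dp)) cCD.
Qed.

Lemma layer_chain_bound c m :
  strict_chain (@layer_le R l) (@layers R l) c m -> (m <= #|{: idx l}|)%N.
Proof.
move=> [cL cl]; suff h i : (i <= m)%N -> (i <= #|carrier (c i)|)%N.
  by apply: leq_trans (h m (leqnn m)) _; exact: max_card.
elim: i => // i IH im; apply: leq_ltn_trans (IH (ltnW im)) _.
by apply: proper_card; apply: carrier_proper (cl _ im); apply: cL => //; exact: ltnW.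
Qed.

End Layers.

(** * One-parameter curves in layers *)

Section Curves.
Variables (R : realType) (l : nat).
Implicit Types (C D E : set (pt R l)) (t : pt R l) (F G : {set idx l}).

Lemma hyp_torus (h : idx l) t : hyp h t -> torus t.
Proof. by case: h => [i|[p []]] []. Qed.

Lemma hyp1P i t : torus t -> hyp (inl i) t <-> t.1 0 i = 1 /\ t.2 0 i = 0.
Proof.
move=> tt; split=> [[_ []] //|[h1 h2]]; split=> //.
by rewrite /Defs.coord h1 h2.
Qed.

(** On the unit circle inversion is conjugation: the second coordinate is the conjugate of the first
    for [b = true], and equal to it for [b = false]. *)
Lemma hyp2P p b t : torus t -> hyp (inr (p, b)) t <->
  t.1 0 (val p).2 = t.1 0 (val p).1 /\
  t.2 0 (val p).2 = (-1) ^+ b * t.2 0 (val p).1.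
Proof.
move=> tt; have /= := tt (val p).1; have /= := tt (val p).2.
case: b => /=; rewrite /cmul /cinv /cone /Defs.coord /=;
  set x1 := t.1 0 (val p).1; set x2 := t.1 0 (val p).2;
  set y1 := t.2 0 (val p).1; set y2 := t.2 0 (val p).2;
  rewrite ?expr1 ?expr0 => n2 n1.
- split=> [[_ [e1 e2]]|[-> ->]].
    split; apply/eqP; rewrite -subr_eq0; apply/eqP.
      (* This identity and the three like it are, up to sign, real and imaginary parts of the
         defining equation times the conjugate of the first coordinate, corrected by its norm. *)
      rewrite (_ : _ - _ = x1 * (x1 * x2 - y1 * y2 - 1) +
        y1 * (x1 * y2 + y1 * x2) - x2 * (x1 ^+ 2 + y1 ^+ 2 - 1)); last by ring.
      by rewrite n1 e1 e2; ring.
    rewrite (_ : _ - _ = x1 * (x1 * y2 + y1 * x2)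
      - y1 * (x1 * x2 - y1 * y2 - 1) - y2 * (x1 ^+ 2 + y1 ^+ 2 - 1)); last by ring.
    by rewrite n1 e1 e2; ring.
  split=> //; congr (_, _); first by rewrite -[RHS]n1; ring.
  by ring.
- rewrite n2 !divr1; split=> [[_ [e1 e2]]|[-> ->]].
    split; apply/eqP; rewrite -subr_eq0; apply/eqP.
      rewrite (_ : _ - _ = x1 * (x1 * x2 - y1 * - y2 - 1) +
        y1 * (x1 * - y2 + y1 * x2) - x2 * (x1 ^+ 2 + y1 ^+ 2 - 1)); last by ring.
      by rewrite n1 e1 e2; ring.
    rewrite (_ : _ - _ = - x1 * (x1 * - y2 + y1 * x2)
      + y1 * (x1 * x2 - y1 * - y2 - 1) - y2 * (x1 ^+ 2 + y1 ^+ 2 - 1)); last by ring.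
    by rewrite n1 e1 e2; ring.
  split=> //; congr (_, _); first by rewrite -[RHS]n1; ring.
  by ring.
Qed.

(** In complex notation the coordinates are [s e^(i n_k a)]: for [s = 1] a one-parameter subgroup at
    time [a], for [s = -1] its translate through (-1, .., -1). *)
Definition curve (s : R) (n : 'I_l -> R) (a : R) : pt R l :=
  (\row_k (s * cos (n k * a)), \row_k (s * sin (n k * a))).

Definition pm (s : R) : pt R l := (\row_k s, \row_k 0).

Lemma curve0 s n : curve s n 0 = pm s.
Proof.
by congr (_, _); apply/rowP => k; rewrite !mxE mulr0 ?cos0 ?sin0 ?mulr1 ?mulr0.
Qed.

Lemma cos_signr (b : bool) (x : R) : cos ((-1) ^+ b * x) = cos x.
Proof. by case: b; rewrite ?expr1 ?expr0 ?mulN1r ?mul1r ?cosN. Qed.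

Lemma sin_signr (b : bool) (x : R) : sin ((-1) ^+ b * x) = (-1) ^+ b * sin x.
Proof. by case: b; rewrite ?expr1 ?expr0 ?mulN1r ?mul1r ?sinN. Qed.

Lemma curve_torus s n a : s ^+ 2 = 1 -> torus (curve s n a).
Proof.
move=> s2 k; rewrite /Defs.coord /= !mxE !exprMn s2 !mul1r; exact: cos2Dsin2.
Qed.

(** The linear condition keeping the whole curve inside the hypertorus; [t_i = 1] also constrains
    the starting point, whence [s = 1]. *)
Definition speeds_in (s : R) (n : 'I_l -> R) (h : idx l) : Prop :=
  match h with
  | inl i => s = 1 /\ n i = 0
  | inr (p, b) => n (val p).2 = (-1) ^+ b * n (val p).1
  end.

Lemma curve_hyp s n a h : s ^+ 2 = 1 -> speeds_in s n h -> hyp h (curve s n a).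
Proof.
move=> s2; have tt := curve_torus n a s2; case: h => [i|[p b]] /=.
  by move=> [s1 ni]; apply/hyp1P => //=; rewrite !mxE s1 ni mul0r cos0 sin0 mulr1 mulr0.
move=> np; apply/(hyp2P p b tt) => /=; rewrite !mxE np -mulrA cos_signr sin_signr.
by rewrite mulrCA.
Qed.

Lemma row_continuous (f : R -> 'rV[R]_l) :
  (forall k, continuous (fun x => f x 0 k)) -> continuous f.
Proof.
move=> fc x A [P Px PA].
have : \forall y \near x, forall k, P 0 k (f y 0 k).
  apply: (@filter_forall R 'I_l (fun k y => P 0 k (f y 0 k)) (nbhs x)) => k.
  exact: (fc k x _ (Px 0 k)).
by apply: filterS => y Py; apply: PA => i k; rewrite ord1.
Qed.

Lemma curve_continuous s n : continuous (curve s n).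
Proof.
pose f u a : 'rV[R]_l := \row_k (s * u (n k * a)).
have fc u : continuous u -> continuous (f u).
  move=> uc; apply: row_continuous => k x.
  have -> : (fun a => f u a 0 k) = (fun a => s * u (n k * a)).
    by apply/funext => y; rewrite mxE.
  apply: cvgM; first exact: cvg_cst.
  apply: (@continuous_comp _ _ _ (fun a => n k * a) u); last exact: uc.
  by apply: cvgM; [exact: cvg_cst|exact: cvg_id].
move=> a; exact: (cvg_pair (fc _ (@continuous_cos R) a)
  (fc _ (@continuous_sin R) a)).
Qed.

(** The curve is connected, stays in the intersection and passes through [pm s] at time 0, so it
    never leaves the component of that point. *)
Lemma curve_layer_at s n F a : s ^+ 2 = 1 ->
  (forall h, h \in F -> speeds_in s n h) -> layer_at F (pm s) (curve s n a).
Proof.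
move=> s2 sF; suff : range (curve s n) `<=` layer_at F (pm s) by apply; exists a.
apply: layer_at_max; first by exists 0 => //; exact: curve0.
  apply: connected_continuous_connected.
    by apply/connected_intervalP => x y _ _ z _.
  by apply: continuous_subspaceT; exact: curve_continuous.
move=> _ [b _ <-]; split; first exact: curve_torus.
by move=> h hF; apply: curve_hyp => //; exact: sF.
Qed.

Lemma curve_layer C s n a : s ^+ 2 = 1 -> layers C -> C (pm s) ->
  (forall h, h \in carrier C -> speeds_in s n h) -> C (curve s n a).
Proof. by move=> s2 LC Cs sC; rewrite (layerE LC Cs); exact: curve_layer_at. Qed.

(** The sign of [y] decides between [acos x] and its opposite. The last clause gives a coordinate
    equal to 1 the speed 0 in [torus_angles]. *)
Lemma unit_circle_angle (x y : R) : x ^+ 2 + y ^+ 2 = 1 ->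
  exists a, [/\ x = cos a, y = sin a & (x = 1 -> a = 0)].
Proof.
move=> xy; have x2 : x ^+ 2 <= 1 by rewrite -xy lerDl sqr_ge0.
have xB : -1 <= x <= 1.
  by rewrite -ler_norml -(ler_pXn2r (ltn0Sn 1)) ?nnegrE ?expr1n ?real_normK ?num_real.
have sa : Num.sqrt (1 - x ^+ 2) = `|y|.
  by rewrite (_ : 1 - x ^+ 2 = y ^+ 2) ?sqrtr_sqr // -xy; ring.
have ca : cos (acos x) = x by apply: acosK; rewrite in_itv.
have a1 : x = 1 -> acos x = 0 by move=> ->; exact: acos1.
have [y0|y0] := leP 0 y.
  by exists (acos x); split=> //; rewrite sin_acos // sa ger0_norm.
exists (- acos x); split; rewrite ?cosN ?sinN ?sin_acos //.
  by rewrite sa ltr0_norm // opprK.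
by move=> /a1 ->; rewrite oppr0.
Qed.

Lemma torus_angles t : torus t -> exists n, [/\ t = curve 1 n 1 &
  forall k, t.1 0 k = 1 -> n k = 0].
Proof.
move=> tt; have /choice[n nE] k := unit_circle_angle (tt k).
exists n; split=> [|k]; last by have [_ _] := nE k; apply.
rewrite [LHS]surjective_pairing; congr (_, _); apply/rowP => k;
  by have [e1 e2 _] := nE k; rewrite mxE mulr1 mul1r.
Qed.

Lemma layer_at_torus : layer_at finset.set0 (pm 1) = @torus R l.
Proof.
apply/seteqP; split=> t; first by move=> /connected_component_sub[].
move=> /torus_angles[n [-> _]]; apply: curve_layer_at; first exact: expr1n.
by move=> h; rewrite finset.in_set0.
Qed.

(** Connectedness of the hypertori: each point is joined to (1, .., 1) by a curve that stays
    inside. *)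
Lemma layer_at_hyp h : layer_at [set h]%SET (pm 1) = @hyp R l h.
Proof.
apply/seteqP; split=> t.
  by move=> /connected_component_sub[_]; apply; rewrite finset.inE.
move=> ht; have tt := hyp_torus ht; have [n [tn n0]] := torus_angles tt.
have s2 : 1 ^+ 2 = 1 :> R by exact: expr1n.
case: h ht => [i|[p b]] ht.
  rewrite tn; apply: curve_layer_at => // h; rewrite finset.inE => /eqP -> /=.
  by split=> //; apply: n0; have [] := (hyp1P i tt).1 ht.
have p12 : (val p).1 != (val p).2 by rewrite -val_eqE neq_ltn (valP p).
(* Angles chosen coordinate by coordinate satisfy the relation of the pair only modulo a full turn,
   so the second angle is replaced by the signed first one. *)
pose n' k := if k == (val p).2 then (-1) ^+ b * n (val p).1 else n k.
have -> : t = curve 1 n' 1.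
  have [e1 e2] := (hyp2P p b tt).1 ht.
  rewrite [LHS]surjective_pairing; congr (_, _); apply/rowP => k; rewrite mxE /n'.
    case: eqP => [->|_]; last by rewrite tn mxE.
    by rewrite e1 tn mxE -mulrA cos_signr.
  case: eqP => [->|_]; last by rewrite tn mxE.
  by rewrite e2 tn mxE -mulrA sin_signr mulrCA.
apply: curve_layer_at => // h; rewrite finset.inE => /eqP -> /=.
by rewrite /n' eqxx (negPf p12).
Qed.

Lemma pm_torus s : s ^+ 2 = 1 -> torus (pm s).
Proof. by move=> s2; rewrite -(curve0 s (fun=> 0)); exact: curve_torus. Qed.

Lemma pm1_hyp h : hyp h (pm 1).
Proof.
rewrite -(curve0 1 (fun=> 0)); apply: curve_hyp; first exact: expr1n.
by case: h => [i|[p b]] //=; rewrite mulr0.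
Qed.

End Curves.

(** * Layers through (1, .., 1) and (-1, .., -1) *)

Section Points.
Variables (R : realType) (l : nat).
Implicit Types (C D y : set (pt R l)) (t : pt R l) (F G : {set idx l}) (s : R).

Definition pair_idx (i j : 'I_l) (ij : (i < j)%N) (b : bool) : idx l :=
  inr (exist _ (i, j) ij, b).

(** Otherwise the image of [C] in the line is an interval containing 1 and -1, hence 0. *)
Lemma connected_sqr_eq1 C (k : 'I_l) t u : connected C ->
  (forall v, C v -> v.1 0 k ^+ 2 = 1) -> C t -> C u -> t.1 0 k = u.1 0 k.
Proof.
move=> Cc C1.
have fc : continuous (fun v : pt R l => v.1 0 k).
  move=> v; apply: (@continuous_comp _ _ _ fst (fun M : 'rV[R]_l => M 0 k)).
    exact: cvg_fst.
  exact: coord_continuous.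
have /connected_intervalP I : connected ((fun v : pt R l => v.1 0 k) @` C).
  by apply: connected_continuous_connected => //; exact: continuous_subspaceT.
have no0 v w : C v -> C w -> v.1 0 k = 1 -> w.1 0 k = -1 -> False.
  move=> Cv Cw v1 w1; have [|||z Cz z0] := I (-1) 1 _ _ 0 _.
  - by exists w.
  - by exists v.
  - by apply/andP; split; lra.
  - by move: (C1 z Cz); rewrite z0 expr0n /= => /eqP; rewrite eq_sym oner_eq0.
move=> Ct Cu; have /eqP := C1 t Ct; have /eqP := C1 u Cu.
rewrite !sqrf_eq1 => /orP[]/eqP u1 /orP[]/eqP t1; rewrite ?u1 ?t1 //.
  by case: (no0 u t).
by case: (no0 t u).
Qed.

Lemma connected_pm C (k : 'I_l) s : connected C -> C (pm l s) ->
  (forall t, C t -> exists2 s', s' ^+ 2 = 1 & t = pm l s') ->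
  C = [set pm l s].
Proof.
move=> Cc Cs Cpm; apply/seteqP; split=> [t Ct|t ->] //=.
have := connected_sqr_eq1 (k := k) Cc _ Ct Cs.
have [s' s'2 ->] := Cpm t Ct; rewrite !mxE => <- // v Cv.
by have [s'' ? ->] := Cpm v Cv; rewrite mxE.
Qed.

Lemma pm_pair_hyp s i j ij b : s ^+ 2 = 1 -> hyp (@pair_idx i j ij b) (pm l s).
Proof.
move=> s2; have st : torus (pm l s) := pm_torus (l := l) s2.
by apply/hyp2P => //=; rewrite !mxE mulr0.
Qed.

Lemma pm_inr_hyp s q : s ^+ 2 = 1 -> hyp (inr q) (pm l s).
Proof. by case: q => [[[i j] ij] b]; exact: pm_pair_hyp. Qed.

Lemma pmN1_inl_hyp i : ~ hyp (inl i) (pm l (-1 : R)).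
Proof.
have st : torus (pm l (-1 : R)) by apply: pm_torus; rewrite sqrrN expr1n.
move=> /(hyp1P i st)[]; rewrite mxE => /eqP; rewrite -subr_eq0.
rewrite (_ : -1 - 1 = - 2%:R :> R); last by ring.
by rewrite oppr_eq0 pnatr_eq0.
Qed.

(** Exactly the hypertori that pass through (-1, .., -1). *)
Definition pairs : {set idx l} :=
  [set h : idx l | if h is inl _ then false else true]%SET.

Lemma pm_inter_pairs s : s ^+ 2 = 1 -> inter pairs (pm l s).
Proof.
move=> s2; split; first exact: pm_torus.
by move=> [i|q]; rewrite finset.inE // => _; exact: pm_inr_hyp.
Qed.

(** The two relations make the second coordinate equal both to the first and to its conjugate. *)
Lemma both_signs i j ij t : hyp (@pair_idx i j ij true) t ->
  hyp (@pair_idx i j ij false) t -> t.2 0 i = 0.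
Proof.
move=> hT hF; have tt := hyp_torus hT.
have [_ /= e1] := (hyp2P _ _ tt).1 hT; have [_ /= e2] := (hyp2P _ _ tt).1 hF.
by move: e1 e2; rewrite expr1 expr0 => -> ; lra.
Qed.

Hypothesis l2 : (1 < l)%N.
Let o0 : 'I_l := Ordinal (ltnW l2).
Let o1 : 'I_l := Ordinal l2.

Lemma inter_pairs_pm t : inter pairs t -> exists2 s, s ^+ 2 = 1 & t = pm l s.
Proof.
move=> [tt th]; have hp i j ij b : hyp (@pair_idx i j ij b) t.
  by apply: th; rewrite finset.inE.
have y0 := both_signs (hp o0 o1 isT true) (hp o0 o1 isT false).
exists (t.1 0 o0); first by have := tt o0; rewrite /= y0 expr0n addr0.
have tk k : t.1 0 k = t.1 0 o0 /\ t.2 0 k = 0.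
  have [->//|k0] := eqVneq k o0.
  have lk : (o0 < k)%N by rewrite lt0n.
  by have [-> ->] := (hyp2P _ _ tt).1 (hp o0 k lk true); rewrite /= y0 mulr0.
rewrite [LHS]surjective_pairing; congr (_, _); apply/rowP => k; rewrite mxE;
  by case: (tk k).
Qed.

(** All pair hypertori together meet only in (1, .., 1) and (-1, .., -1), which connectedness
    separates. *)
Lemma point_layer s : s ^+ 2 = 1 -> layers [set pm l s].
Proof.
move=> s2; have h := pm_inter_pairs s2.
suff -> : [set pm l s] = layer_at pairs (pm l s) by exact: layers_layer_at.
apply/esym/(connected_pm o0); [exact: component_connected|exact: layer_at_self|].
by move=> t /connected_component_sub /inter_pairs_pm.
Qed.

Lemma point_maximal s : s ^+ 2 = 1 ->
  maximal_in (@layer_le R l) (@layers R l) [set pm l s].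
Proof.
move=> s2; split; first exact: point_layer.
move=> y Ly ys; have [t yt] := layer_nonempty Ly.
by apply/seteqP; split=> // u ->; rewrite -(ys _ yt).
Qed.

Lemma curve_pi s n (k : 'I_l) : n k = 1 \/ n k = -1 ->
  (curve s n pi).1 0 k = - s /\ (curve s n pi).2 0 k = 0.
Proof.
by rewrite !mxE => -[] ->; rewrite ?mulN1r ?mul1r ?cosN ?sinN cospi sinpi
  ?oppr0 mulr0 mulrN1.
Qed.

Lemma curve_stay s n (k : 'I_l) a : n k = 0 -> (curve s n a).1 0 k = s.
Proof. by rewrite !mxE => ->; rewrite mul0r cos0 mulr1. Qed.

Lemma signr_pm (b : bool) : (-1) ^+ b = 1 :> R \/ (-1) ^+ b = -1 :> R.
Proof. by case: b; [right|left]. Qed.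

Lemma curve_to_pmN s n : (forall k, n k = 1 \/ n k = -1) ->
  curve s n pi = pm l (- s).
Proof.
move=> n1; rewrite [LHS]surjective_pairing; congr (_, _); apply/rowP => k;
  by have [e1 e2] := curve_pi s (n1 k); rewrite ?e1 ?e2 mxE.
Qed.

(** * Join-closed order ideals containing one of the two points *)

Section JoinClosedIdeal.
Variable Q : set (set (pt R l)).
Hypothesis Qjoin : Defs.join_closed (@layer_le R l) (@layers R l) Q.
Hypothesis Qideal : order_ideal (@layer_le R l) (@layers R l) Q.

(** All hypertori pass through (1, .., 1) and so belong to [Q]; every layer is a minimal upper bound
    of the hypertori containing it. *)
Lemma ideal_pm1 : Q [set pm l 1] -> Q = @layers R l.
Proof.
move=> Q1; have [QL Qd] := Qideal; apply/seteqP; split=> // C LC.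
apply: (Qjoin (S := [set D | exists2 h, h \in carrier C & D = @hyp R l h])).
  move=> _ [h _ ->]; apply: (Qd [set pm l 1]) => //.
    by exists [set h]%SET, (pm l 1); split; [split; [exact/pm_torus/expr1n|
      move=> h' _; exact: pm1_hyp]|rewrite -layer_at_hyp].
  by move=> _ ->; exact: pm1_hyp.
split=> //; split; first by move=> _ [h /carrierP hC ->].
move=> D LD Dub CD; apply/seteqP; split=> //.
have [p Cp] := layer_nonempty LC; rewrite (layerE LC Cp).
apply: layer_sub_layer_at => //; first exact: CD.
by apply/fintype.subsetP => h hC; apply/carrierP; apply: (Dub (hyp h)); exists h.
Qed.

(** The components through (-1, .., -1) of the pair hypertori lie in [Q] and, by a half turn,
    contain (1, .., 1). An upper bound of them through (1, .., 1) is connected and has only points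
    [pm l s], so it is that single point. *)
Lemma ideal_pmN1 : Q [set pm l (-1)] -> Q [set pm l 1].
Proof.
move=> QN; have [QL Qd] := Qideal.
have N2 : (-1) ^+ 2 = 1 :> R by rewrite sqrrN expr1n.
pose S := [set D | exists q, D = layer_at [set inr q]%SET (pm l (-1 : R))].
have i_q q : inter [set inr q]%SET (pm l (-1 : R)).
  by split=> [|h]; [exact: pm_torus|rewrite finset.inE => /eqP ->; exact: pm_inr_hyp].
apply: (Qjoin (S := S)).
  move=> _ [q ->]; apply: (Qd _ _ QN); first exact/layers_layer_at.
  by move=> _ ->; exact: layer_at_self.
split; first exact/point_layer/expr1n.
split=> [_ [[p b] ->] _ ->|D LD Dub D1].
  pose n k : R := if k == (val p).2 then (-1) ^+ b else 1.
  have -> : pm l 1 = curve (-1) n pi.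
    rewrite curve_to_pmN ?opprK // /n => k.
    by case: ifP => _; [exact: signr_pm|left].
  apply: curve_layer_at => // h; rewrite finset.inE => /eqP -> /=.
  by rewrite /n eqxx -val_eqE ltn_eqF ?mulr1 // (valP p).
apply/(connected_pm o0); [exact: layer_connected|exact: D1|].
move=> t Dt; apply: inter_pairs_pm; split=> [|[i|q]].
- by have [] := inter_carrier LD Dt.
- by rewrite finset.inE.
- move=> _; have Sq : S (layer_at [set inr q]%SET (pm l (-1))) by exists q.
  have /connected_component_sub[_] := Dub _ Sq _ Dt.
  by apply; rewrite finset.inE.
Qed.

End JoinClosedIdeal.

Lemma torus_bottom : is_bottom (@layer_le R l) (@layers R l) (@torus R l).
Proof.
split; last by move=> C LC t /(inter_carrier LC)[].
rewrite -layer_at_torus; apply: layers_layer_at; split; first exact/pm_torus/expr1n.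
by move=> h; rewrite finset.in_set0.
Qed.

(** This is [modular_meets_rank2] for the components [a] of [h1] and [w] of the intersection of both
    hypertori: if no hypertorus contained [y] and [w], their meet would be the whole torus. *)
Lemma coatom_meets r y c s h1 h2 : s ^+ 2 = 1 ->
  (forall d m, strict_chain (@layer_le R l) (@layers R l) d m -> (m <= r.+1)%N) ->
  modular_in (@layer_le R l)
    (lower_interval (@layer_le R l) (@layers R l) [set pm l s]) y ->
  strict_chain (@layer_le R l) (@layers R l) c r -> c r = y ->
  hyp h1 (pm l s) -> hyp h2 (pm l s) ->
  ~ layer_at [set h1]%SET (pm l s) `<=` hyp h2 ->
  exists h, h \in carrier y /\ h \in carrier (layer_at [set h1; h2]%SET (pm l s)).
Proof.
move=> s2 bnd ymod cr cy h1s h2s nsub; apply: contrapT => nh.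
have [[Ly ys] _] := ymod.
have i1 : inter [set h1]%SET (pm l s).
  by split=> [|h]; [exact: pm_torus|rewrite finset.inE => /eqP ->].
have i2 : inter [set h1; h2]%SET (pm l s).
  by split=> [|h]; [exact: pm_torus|rewrite !finset.inE => /orP[]/eqP ->].
set a := layer_at [set h1]%SET (pm l s) in nsub.
set w := layer_at _ _ in nh.
have aw : layer_le a w.
  apply: layer_at_max; [exact: layer_at_self|exact: component_connected|].
  move=> t /connected_component_sub; apply: interS; apply/fintype.subsetP => h.
  by rewrite !finset.inE => ->.
have w1 : h1 \in carrier w.
  by apply: (fintype.subsetP (sub_carrier_layer_at _ _)); rewrite !finset.inE eqxx.
have w2 : h2 \in carrier w.
  by apply: (fintype.subsetP (sub_carrier_layer_at _ _)); rewrite !finset.inE eqxx orbT.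
apply: (modular_meets_rank2 (x := [set pm l s]) (y := y) (b := @torus R l)
  (a := a) (w := w) (@layer_lexx R l) (@layer_le_trans R l) (@layer_le_anti R l)
  bnd _ _ ymod cr cy torus_bottom).
- move=> u v [Lu us] [Lv vs]; exists (layer_at (carrier u :|: carrier v)%SET (pm l s)).
  by apply: layer_lub => //; [exact: us|exact: vs].
- move=> u v [Lu us] [Lv vs]; exists (layer_at (carrier u :&: carrier v)%SET (pm l s)).
  by apply: layer_glb => //; [exact: us|exact: vs].
- by split; [exact: layers_layer_at|move=> _ ->; exact: layer_at_self].
- by split; [exact: layers_layer_at|move=> _ ->; exact: layer_at_self].
- split; first exact: (proj2 torus_bottom) (layers_layer_at i1).
  move=> ta; apply: nh; exists h1; split=> //; apply/carrierP => t yt.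
  have : a t by rewrite -ta; have [] := inter_carrier Ly yt.
  by move=> /connected_component_sub[_]; apply; rewrite finset.inE.
- by split=> // awE; apply: nsub; rewrite awE; exact/carrierP.
- have -> : @torus R l = layer_at (carrier y :&: carrier w)%SET (pm l s).
    rewrite (_ : _ :&: _ = finset.set0)%SET; last first.
      apply/finset.setP => h; rewrite finset.in_set0 finset.inE.
      by apply/negP => /andP[hy hw]; apply: nh; exists h.
    apply/seteqP; split; last by move=> t /connected_component_sub[].
    by apply: layer_sub_layer_at (proj1 torus_bottom) (pm_torus s2) _; exact: finset.sub0set.
  apply: layer_glb => //; [exact: layers_layer_at|exact: ys|exact: layer_at_self].
Qed.

End Points.

(** * Rank at least three *)

Section NotSupersolvable.
Variables (R : realType) (l : nat).
Implicit Types (C D y : set (pt R l)) (t : pt R l) (F G : {set idx l}) (s : R).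
Hypothesis l3 : (2 < l)%N.
Let l2 : (1 < l)%N := ltnW l3.
Let o0 : 'I_l := Ordinal (ltnW l2).
Let o1 : 'I_l := Ordinal l2.
Let o2 : 'I_l := Ordinal l3.

Let one2 : 1 ^+ 2 = 1 :> R. Proof. exact: expr1n. Qed.
Let N2 : (-1) ^+ 2 = 1 :> R. Proof. by rewrite sqrrN expr1n. Qed.

(** Either kind of pair hypertorus forces equal real parts, so a half turn of only one of the two
    coordinates leaves it. *)
Lemma not_x_eq s (q : 'I_l * 'I_l) : s ^+ 2 = 1 -> forall t lt b,
  t.1 0 q.1 = s /\ t.1 0 q.2 = - s \/ t.1 0 q.1 = - s /\ t.1 0 q.2 = s ->
  ~ hyp (inr (exist _ q lt, b)) t.
Proof.
move=> s2 t lt b xs ht; have [/= e _] := (hyp2P _ _ (hyp_torus ht)).1 ht.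
have sN : s = - s by case: xs => -[<- <-].
by have : s = 0 by [lra]; move=> s0; move: s2; rewrite s0 expr0n /= => /eqP;
  rewrite eq_sym oner_eq0.
Qed.

(** In [coatom_meets], the two relations between [t_i] and [t_j] give [w], on which both are -1. A
    hypertorus containing [w] is a pair hypertorus, by the point (-1, .., -1), and involves no third
    coordinate, as those are free on [w]. *)
Lemma modular_pmN1_pair r y c :
  (forall d m, strict_chain (@layer_le R l) (@layers R l) d m -> (m <= r.+1)%N) ->
  modular_in (@layer_le R l)
    (lower_interval (@layer_le R l) (@layers R l) [set pm l (-1)]) y ->
  strict_chain (@layer_le R l) (@layers R l) c r -> c r = y ->
  forall (i j : 'I_l) (ij : (i < j)%N), exists b, pair_idx ij b \in carrier y.
Proof.
move=> bnd ymod cr cy i j ij; have [[Ly ys] _] := ymod.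
have ji : (j == i) = false by rewrite -val_eqE gtn_eqF.
have [| h [hy hw]] := @coatom_meets R l r y c (-1) (pair_idx ij true)
  (pair_idx ij false) N2 bnd ymod cr cy (pm_pair_hyp _ _ N2) (pm_pair_hyp _ _ N2).
  (* Opposite speeds keep [t_i t_j = 1]; after a quarter turn the two coordinates are distinct
     imaginary numbers. *)
  pose n k : R := if k == i then 1 else if k == j then -1 else 0.
  have : layer_at [set pair_idx ij true]%SET (pm l (-1 : R)) (curve (-1) n (pi / 2)).
    apply: curve_layer_at => // h; rewrite finset.inE => /eqP -> /=.
    by rewrite /n ji !eqxx expr1 mulr1.
  move=> Cc /(_ _ Cc) ht; have [_] := (hyp2P _ _ (hyp_torus ht)).1 ht.
  rewrite /= !mxE /n ji !eqxx expr0 !mulN1r !mul1r sinN sin_pihalf; lra.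
have i12 : inter [set pair_idx ij true; pair_idx ij false]%SET (pm l (-1 : R)).
  by split=> [|k]; [exact: pm_torus|
    rewrite !finset.inE => /orP[]/eqP ->; exact: pm_pair_hyp].
move: h hy hw => [k|[[[p q] /= pq] b]] /carrierP hy /carrierP hw.
  by case: (@pmN1_inl_hyp R l k); apply: hy; exact: ys.
(* A half turn of the coordinate [k] alone stays in [w] but flips exactly one of the coordinates [p]
   and [q]. *)
have move_out k : k != i -> k != j -> (p == k) (+) (q == k) -> False.
  move=> ki kj pqk; pose n k' : R := (k' == k)%:R.
  have /hw : layer_at [set pair_idx ij true; pair_idx ij false]%SET (pm l (-1 : R))
      (curve (-1) n pi).
    apply: curve_layer_at => // h; rewrite !finset.inE => /orP[]/eqP -> /=;
    by rewrite /n eq_sym (negPf kj) eq_sym (negPf ki) mulr0.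
  apply: (not_x_eq (s := -1)) => //=; move: pqk.
  have [-> |pk] := eqVneq p k; have [-> |qk] := eqVneq q k => //= _.
    right; split; first by apply: (curve_pi _ _).1; left; rewrite /n eqxx.
    by apply: curve_stay; rewrite /n (negPf qk).
  left; split; last by apply: (curve_pi _ _).1; left; rewrite /n eqxx.
  by apply: curve_stay; rewrite /n (negPf pk).
have pq' : p != q by rewrite -val_eqE ltn_eqF.
have [pi'|pi'] := eqVneq p i.
  subst p; have [qj|qj] := eqVneq q j.
    subst q; exists b; rewrite /pair_idx (bool_irrelevance ij pq).
    exact/carrierP.
  by case: (move_out q); rewrite ?eqxx ?(negPf pq') // eq_sym.
have [pj|pj] := eqVneq p j; last first.
  by case: (move_out p) => //; rewrite eqxx eq_sym (negPf pq').
subst p; case: (move_out q); rewrite ?eqxx ?(negPf pq') // 1?eq_sym //.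
by rewrite -val_eqE /= ltn_eqF // (ltn_trans ij).
Qed.

(** On [y] each coordinate is the first one or its conjugate, as recorded by [e]. The half turn with
    these signs as speeds leads to (1, .., 1) inside [y], unless a further hypertorus makes the
    first coordinate real and shrinks [y] to a point. *)
Lemma contains_pm1 y : layers y -> y (pm l (-1)) -> y <> [set pm l (-1)] ->
  (forall (i j : 'I_l) (ij : (i < j)%N), exists b, pair_idx ij b \in carrier y) ->
  y (pm l 1).
Proof.
move=> Ly ys yn yp.
have /choice[e eE] : forall k : 'I_l, exists b : bool, forall t, y t ->
    t.1 0 k = t.1 0 o0 /\ t.2 0 k = (-1) ^+ b * t.2 0 o0.
  move=> k; have [->|k0] := eqVneq k o0.
    by exists false => t _; rewrite expr0 mul1r.
  have lk : (o0 < k)%N by rewrite lt0n.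
  have [b /carrierP hb] := yp o0 k lk; exists b => t /hb ht.
  exact: ((hyp2P _ _ (hyp_torus ht)).1 ht).
pose n k : R := (-1) ^+ e k.
have n1 k : n k = 1 \/ n k = -1 by exact: signr_pm.
have [yin|] := pselect (forall h, h \in carrier y -> speeds_in (-1) n h).
  by rewrite -(opprK 1) -(curve_to_pmN _ n1); exact: curve_layer.
move=> /existsNP[h /not_implyP[/carrierP hy hn]]; case: yn.
apply: (connected_pm o0) => //; first exact: layer_connected.
move=> t yt; case: h hy hn => [k|[[[p q] pq] b]] hy hn.
  by case: (@pmN1_inl_hyp R l k); exact: hy.
have tt := hyp_torus (hy _ yt).
have [/= _] := (hyp2P _ _ tt).1 (hy _ yt).
have [_ ->] := eE q t yt; have [_ ->] := eE p t yt => yy.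
(* The sign in [h] is opposite to the one implied by [e], so the imaginary part is its own
   negative. *)
have y0 : t.2 0 o0 = 0.
  move: yy hn; rewrite /= /n mulrA -!signr_addb.
  case: (e q) (b (+) e p) => [] [] //=; rewrite ?expr0 ?expr1; lra.
exists (t.1 0 o0); first by have := tt o0; rewrite /= y0 expr0n addr0.
rewrite [LHS]surjective_pairing; congr (_, _); apply/rowP => k; rewrite mxE;
  by have [e1 e2] := eE k t yt; rewrite ?e1 ?e2 ?y0 ?mulr0.
Qed.

(** If [y] contained both points, it would violate one of the two relations between the coordinates
    [o1] and [o2], say of sign [s]. The layer through (1, .., 1) cut out by [inl o0] and
    [pair_idx lt12 s] then shares no hypertorus with [y], against [coatom_meets]. *)
Lemma not_modular_pm1 r y c :
  (forall d m, strict_chain (@layer_le R l) (@layers R l) d m -> (m <= r.+1)%N) ->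
  modular_in (@layer_le R l)
    (lower_interval (@layer_le R l) (@layers R l) [set pm l 1]) y ->
  strict_chain (@layer_le R l) (@layers R l) c r -> c r = y ->
  ~ y (pm l (-1)).
Proof.
move=> bnd ymod cr cy yN; have [[Ly ys] _] := ymod.
have y1 : y (pm l 1) by exact: ys.
have lt12 : (o1 < o2)%N by [].
have [s sy] : exists s : bool, pair_idx lt12 s \notin carrier y.
  apply: contrapT => nex.
  have all b : y `<=` hyp (pair_idx lt12 b).
    by apply/carrierP/negPn/negP => hb; apply: nex; exists b.
  (* Both relations would make the coordinate [o1] real on [y], hence constant, although it takes
     the values 1 and -1. *)
  have := connected_sqr_eq1 (k := o1) (layer_connected Ly) _ y1 yN.
  rewrite !mxE => eq1; have : 1 = -1 :> R.
    apply: eq1 => v yv; have := hyp_torus (all true v yv) o1; rewrite /=.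
    by rewrite (both_signs (all true v yv) (all false v yv)) expr0n addr0.
  by lra.
have hs1 (h : idx l) : hyp h (pm l (1 : R)) by exact: pm1_hyp.
have n21 : (o2 == o1) = false by []. have n01 : (o0 == o1) = false by [].
have n02 : (o0 == o2) = false by [].
have [|h [hy hw]] := @coatom_meets R l r y c 1 (inl o0) (pair_idx lt12 s)
  one2 bnd ymod cr cy (hs1 _) (hs1 _).
  pose n k : R := (k == o1)%:R.
  have : layer_at [set inl o0]%SET (pm l (1 : R)) (curve 1 n pi).
    apply: curve_layer_at => // h; rewrite finset.inE => /eqP -> /=.
    by rewrite /n n01.
  move=> Cc /(_ _ Cc); apply: (not_x_eq (s := 1)) => //=; right; split.
    by apply: (curve_pi _ _).1; left; rewrite /n eqxx.
  by apply: curve_stay; rewrite /n n21.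
set F := [set _; _]%SET in hw.
have inF (n : 'I_l -> R) a : n o0 = 0 -> n o2 = (-1) ^+ s * n o1 ->
    layer_at F (pm l 1) (curve 1 n a).
  move=> n0 n2; apply: curve_layer_at => [|k]; first exact: expr1n.
  by rewrite !finset.inE => /orP[]/eqP -> //=.
move: h hy hw => [k|[[[p q] pq] b]] hy /carrierP hw.
  by move/carrierP: hy => /(_ _ yN); exact: pmN1_inl_hyp.
(* A motion inside the layer that turns only [o1] and [o2]; the cases below ask which of [p] and [q]
   are turned. *)
pose n1 k : R := if k == o1 then 1 else if k == o2 then (-1) ^+ s else 0.
have n1_0 : n1 o0 = 0 by rewrite /n1 n01 n02.
have n1_2 : n1 o2 = (-1) ^+ s * n1 o1 by rewrite /n1 n21 !eqxx mulr1.
have n1_pm k : (k == o1) || (k == o2) -> n1 k = 1 \/ n1 k = -1.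
  by rewrite /n1; case: (k == o1) => [_|/= ->]; [left|exact: signr_pm].
have n1_st k : (k == o1) || (k == o2) = false -> n1 k = 0.
  by rewrite /n1; case: (k == o1) => //= ->.
have pq' : p != q by rewrite -val_eqE /= ltn_eqF.
have h1 := hw _ (inF n1 pi n1_0 n1_2).
case p12 : ((p == o1) || (p == o2)); case q12 : ((q == o1) || (q == o2)).
- have [/eqP pE /eqP qE] : p == o1 /\ q == o2.
    by move: (pq) pq'; case/orP: p12 => /eqP ->; case/orP: q12 => /eqP ->;
      rewrite /= ?eqxx.
  (* Both are turned: a quarter turn tells the two signs apart. *)
  subst p q; have h2 := hw _ (inF n1 (pi / 2) n1_0 n1_2).
  have bs : b = ~~ s.
    case: (eqVneq b s) => [bs|]; last by case: (b) (s) => [] [].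
    by case/negP: sy; rewrite /pair_idx (bool_irrelevance lt12 pq) -bs.
  have [_] := (hyp2P _ _ (hyp_torus h2)).1 h2.
  rewrite /= !mxE /n1 n21 !eqxx sin_signr !mul1r sin_pihalf bs.
  by case: (s) => /=; rewrite ?expr0 ?expr1; lra.
- apply: (not_x_eq (s := 1)) h1 => //=; right; split.
    by apply: (curve_pi _ _).1; exact: n1_pm.
  by apply: curve_stay; exact: n1_st.
- apply: (not_x_eq (s := 1)) h1 => //=; left; split.
    by apply: curve_stay; exact: n1_st.
  by apply: (curve_pi _ _).1; exact: n1_pm.
(* Neither is turned: since [q] exceeds [p], it is not [o0], and it can be turned alone inside the
   layer. *)
- pose n k : R := (k == q)%:R.
  have q0 : (o0 == q) = false.
    by rewrite -val_eqE /= ltn_eqF // (leq_ltn_trans _ pq).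
  have /norP[/negPf q1 /negPf q2] := negbT q12.
  have := hw _ (inF n pi _ _); rewrite /n q0 => /(_ erefl).
  rewrite ![_ == q]eq_sym q1 q2 mulr0 => /(_ erefl).
  apply: (not_x_eq (s := 1)) => //=; left; split.
    by apply: curve_stay; rewrite /n (negPf pq').
  by apply: (curve_pi _ _).1; left; rewrite /n eqxx.
Qed.

Lemma not_supersolvable : ~ supersolvable_BL R l.
Proof.
move=> ss; have Pn1 b : @layers R l <> [set b].
  move=> Pb; have := point_layer l2 one2; have := point_layer l2 N2.
  rewrite Pb => /= <- /seteqP[/(_ _ erefl)/= e _].
  have := congr1 (fun t : pt R l => t.1 0 o0) e; rewrite !mxE; lra.
have [r [Q [[_ [Qjoin [Qideal [_ Qmod]]]] QneqL bnd Qmax]]] :=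
  supersolvable_coatoms (@layer_lexx R l) (@layer_le_trans R l)
    (@layer_chain_bound R l) Pn1 ss.
have Q1 : ~ Q [set pm l 1] by move=> /(ideal_pm1 Qjoin Qideal).
have QN : ~ Q [set pm l (-1)] by move=> /(ideal_pmN1 l2 Qjoin Qideal).
have [y [ymax [y1 ymod]]] := Qmod _ (point_maximal l2 one2).
have [z [zmax [zN zmod]]] := Qmod _ (point_maximal l2 N2).
have [cy [cyr cyE]] := Qmax y ymax; have [cz [czr czE]] := Qmax z zmax.
have [Qy Qz] := (proj1 ymax, proj1 zmax).
have [Ly Lz] := (proj1 Qideal y Qy, proj1 Qideal z Qz).
have zn : z <> [set pm l (-1)] by move=> zE; apply: QN; rewrite -zE.
have z1 := contains_pm1 Lz (zN _ erefl) zn (modular_pmN1_pair bnd zmod czr czE).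
(* Both [y] and [z] pass through (1, .., 1); their join [u] there lies in [Q], so maximality gives
   [y = u = z]. *)
have := layer_mub Ly Lz (y1 _ erefl) z1; set u := layer_at _ _ => um.
have Qu : Q u by apply: Qjoin um => _ [->|->].
have [_ [ub _]] := um.
have uy : u = y by apply: (proj2 ymax) => //; apply: ub; left.
have uz : u = z by apply: (proj2 zmax) => //; apply: ub; right.
apply: (not_modular_pm1 bnd ymod cyr cyE); rewrite -uy uz; exact: zN.
Qed.

End NotSupersolvable.

(** * Ranks one and two *)

Section RankOne.
Variable R : realType.

Lemma card_idx1 : #|{: idx 1}| = 1%N.
Proof.
rewrite card_sum card_ord card_prod card_sig eq_card0 // => -[p q].
by rewrite !inE !ord1.
Qed.

Lemma torus_neq_hyp_inl l (i : 'I_l) : @torus R l <> hyp (inl i).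
Proof.
move=> e; apply: (@pmN1_inl_hyp R l i); rewrite -e; apply: pm_torus.
by rewrite sqrrN expr1n.
Qed.

Lemma hyp_layer l (h : idx l) : layers (@hyp R l h).
Proof.
rewrite -layer_at_hyp; apply: layers_layer_at; split; first exact/pm_torus/expr1n.
by move=> k _; exact: pm1_hyp.
Qed.

Lemma supersolvable_B1 : supersolvable_BL R 1.
Proof.
have bT := torus_bottom R 1; pose h : idx 1 := inl ord0.
have Th : plt (@layer_le R 1) (@torus R 1) (hyp h).
  by split; [exact: (proj2 bT) (hyp_layer h)|exact: torus_neq_hyp_inl].
exists 1%N, (fun i => if i is 0%N then [set @torus R 1] else @layers R 1).
split; first by exists (@torus R 1).
split=> //; split=> [[|//] _|[|[|//]] _].
- split; first by move=> _ ->; case: bT.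
  split; last exact: (M_ideal_bottom (@layer_lexx R 1) (@layer_le_anti R 1) bT).
  move=> e; have := hyp_layer h; rewrite -e /= => hT.
  by case: Th => _; apply.
- exact: rank_of_set1.
- apply: (@rank_of_set_chain _ _ _ _ (fun i => if i is 0%N then @torus R 1 else hyp h)).
    by split=> [[|[|//]] _|[|//] _] //; [case: bT|exact: hyp_layer].
  by move=> d m /layer_chain_bound; rewrite card_idx1.
Qed.

End RankOne.

(** * The four hypertori of rank two *)

Section RankTwo.
Variable R : realType.
Let o0 : 'I_2 := Ordinal (isT : 0 < 2)%N.
Let o1 : 'I_2 := Ordinal (isT : 1 < 2)%N.
Let lt01 : (o0 < o1)%N := isT.
Implicit Types (C D : set (pt R 2)) (t : pt R 2) (h : idx 2).

Lemma ord2E (k : 'I_2) : k = o0 \/ k = o1.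
Proof. by case: k => [[|[|//]] k2]; [left|right]; exact: val_inj. Qed.

(** Any two of the four relations leave both coordinates real and equal. *)
Lemma two_hyps h h' t : h != h' -> hyp h t -> hyp h' t ->
  exists2 s, s ^+ 2 = 1 & t = pm 2 s.
Proof.
move=> hh' ht h't; have tt := hyp_torus ht.
suff [y0 y1 x1] : [/\ t.2 0 o0 = 0, t.2 0 o1 = 0 & t.1 0 o1 = t.1 0 o0].
  exists (t.1 0 o0); first by have := tt o0; rewrite /= y0 expr0n addr0.
  rewrite [LHS]surjective_pairing; congr (_, _); apply/rowP => k; rewrite mxE;
  by case: (ord2E k) => ->.
have idxE q : exists b, inr q = pair_idx lt01 b.
  case: q => [[[i j] ij] b]; exists b.
  have [iE jE] : i = o0 /\ j = o1.
    by move: (ij); case: (ord2E i) (ord2E j) => -> [] ->.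
  by subst i j; rewrite /pair_idx (bool_irrelevance ij lt01).
have mix i q : hyp (inl i) t -> hyp (inr q) t ->
    [/\ t.2 0 o0 = 0, t.2 0 o1 = 0 & t.1 0 o1 = t.1 0 o0].
  move=> /(hyp1P _ tt)[_ yi]; have [b ->] := idxE q.
  move=> /(hyp2P _ _ tt)[/= -> y01]; case: (ord2E i) yi => -> yi.
    by rewrite y01 yi mulr0.
  move: yi; rewrite y01 => /eqP; rewrite mulf_eq0 signr_eq0 /= => /eqP ->.
  by rewrite mulr0.
case: h h' hh' ht h't => [i|q] [j|q'] hh' ht h't.
- have [x y] := (hyp1P _ tt).1 ht; have [x' y'] := (hyp1P _ tt).1 h't.
  move: hh' x y x' y'.
  by case: (ord2E i) (ord2E j) => -> [] -> ; rewrite ?eqxx // => _ -> -> -> ->.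
- exact: mix ht h't.
- exact: mix h't ht.
- have [b e] := idxE q; have [b' e'] := idxE q'; move: hh' ht h't.
  rewrite e e' => hh' ht h't.
  have [/= x1 y1] := (hyp2P _ _ tt).1 ht.
  suff y0 : t.2 0 o0 = 0 by rewrite y1 y0 mulr0.
  by case: b b' hh' ht h't {e e' y1} => [] [] hh' ht h't;
    rewrite ?eqxx // in hh' *; apply: (both_signs (ij := lt01)).
Qed.

(** The cases are a presentation by no, one, or at least two hypertori; the last keeps a hypertorus
    through the point, for comparison with atoms. *)
Lemma layer2_cases C : layers C -> [\/ C = @torus R 2, exists h, C = hyp h |
  exists h, exists2 s, s ^+ 2 = 1 & C = [set pm 2 s] /\ hyp h (pm 2 s)].
Proof.
move=> LC; have [F [x [Fx CE]]] := LC.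
have Cx : C x by rewrite CE; exact: connected_component_refl.
have [F1|] := leqP #|F| 1%N; last first.
  move=> /card_gt1P[h [h' [hF h'F hh']]]; apply: Or33; exists h.
  have Cpm t : C t -> exists2 s, s ^+ 2 = 1 & t = pm 2 s.
    rewrite CE => /connected_component_sub[_ tF].
    exact: two_hyps hh' (tF _ hF) (tF _ h'F).
  have [s s2 xs] := Cpm x Cx; exists s => //; subst x; split.
    by apply: (connected_pm o0) => //; exact: layer_connected.
  by have [_] := Fx; exact.
move: F1; rewrite leq_eqVlt ltnS leqn0 => /orP[/cards1P[h hF]|].
  apply: Or32; exists h; rewrite CE hF.
  have e : inter [set h]%SET = @hyp R 2 h.
    apply/seteqP; split=> [t [_]|t ht]; first by apply; rewrite finset.inE.
    by split=> [|k]; [exact: hyp_torus ht|rewrite finset.inE => /eqP ->].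
  rewrite e connected_component_id //; first by rewrite -e -hF.
  by apply: layer_connected; exact: hyp_layer.
rewrite cards_eq0 => /eqP hF; apply: Or31; rewrite CE hF.
have e : inter finset.set0 = @torus R 2.
  by apply/seteqP; split=> [t []//|t tt]; split=> // k; rewrite finset.in_set0.
rewrite e connected_component_id //; first by case: Fx.
by apply: layer_connected; have [] := torus_bottom R 2.
Qed.

(** Otherwise [two_hyps] and connectedness reduce the smaller hypertorus to (1, 1), but a half turn
    inside it leaves that point. *)
Lemma hyp_inj h h' : @hyp R 2 h `<=` hyp h' -> h = h'.
Proof.
move=> hh'; apply/eqP/negPn/negP => nhh'.
have [n [k [sn nk]]] : exists n, exists k, speeds_in (1 : R) n h /\ n k = 1.
  case: h {hh' nhh'} => [i|[p b]].
    case: (ord2E i) => ->; [exists (fun k => (k == o1)%:R), o1|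
      exists (fun k => (k == o0)%:R), o0]; by [].
  exists (fun k => if k == (val p).2 then (-1) ^+ b else 1), (val p).1 => /=.
  by rewrite eqxx -val_eqE /= ltn_eqF ?mulr1 // (valP p).
have hc : hyp h (curve 1 n pi) by apply: curve_hyp => //; exact: expr1n.
have hE : @hyp R 2 h = [set pm 2 1].
  apply: (connected_pm o0); first exact/layer_connected/hyp_layer.
    exact: pm1_hyp.
  by move=> t ht; exact: two_hyps nhh' ht (hh' _ ht).
move: hc; rewrite hE /= => /(congr1 (fun t : pt R 2 => t.1 0 k)).
have [-> _] := curve_pi (1 : R) (or_introl nk : n k = 1 \/ n k = -1).
by rewrite mxE; lra.
Qed.

Lemma torus_neq_hyp h : @torus R 2 <> hyp h.
Proof.
case: h => [i|q]; first exact: torus_neq_hyp_inl.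
move=> e; have := @hyp_inj (inl o0) (inr q); rewrite -e => inj.
by have : inl o0 = inr q by apply: inj => t /hyp_torus.
Qed.

Lemma point_minimal s D : layers D -> ~ plt (@layer_le R 2) [set pm 2 s] D.
Proof.
move=> /layer_nonempty[t Dt] [Ds]; apply; apply/seteqP; split=> // _ ->.
by rewrite -(Ds _ Dt).
Qed.

(** In a longer chain, [d 1] and [d 2] are neither the torus nor a point, hence strictly nested
    hypertori, against [hyp_inj]. *)
Lemma layer2_chain d m :
  strict_chain (@layer_le R 2) (@layers R 2) d m -> (m <= 2)%N.
Proof.
case: m => [|[|[|m]]] // [dL dl]; exfalso.
have bT := torus_bottom R 2.
have step i : (i < 2)%N -> exists h, d i.+1 = hyp h.
  move=> i2; have im : (i.+1 < m.+3)%N by rewrite ltnS (leq_trans i2).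
  have [dT|//|[h [s _ [dE _]]]] := layer2_cases (dL i.+1 (ltnW im)).
    by case: (plt_neq_bottom (@layer_le_anti R 2) bT (dL i (ltnW (ltnW im)))
      (dl i (ltnW im))).
  by case: (@point_minimal s (d i.+2)); [exact: dL|rewrite -dE; exact: dl].
have [h1 e1] := step 0 isT; have [h2 e2] := step 1 isT.
have [] := dl 1 isT; rewrite e1 e2 => /hyp_inj ->.
by apply.
Qed.

(** The middle ideal is generated by [H], the hypertorus where both coordinates agree: it contains
    (1, 1) and (-1, -1), hence lies below every maximal layer. *)
Lemma supersolvable_B2 : supersolvable_BL R 2.
Proof.
have bT := torus_bottom R 2; pose H := @hyp R 2 (pair_idx lt01 false).
have one2 : 1 ^+ 2 = 1 :> R by exact: expr1n.
have LH : layers H by exact: hyp_layer.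
have TH : plt (@layer_le R 2) (@torus R 2) H.
  by split; [exact: (proj2 bT)|exact: torus_neq_hyp].
have Lp : layers [set pm 2 (1 : R)] by exact: point_layer.
have Hp : plt (@layer_le R 2) H [set pm 2 (1 : R)].
  split=> [_ ->|e]; first exact: pm1_hyp.
  have : H (pm 2 (-1)) by apply: pm_pair_hyp; rewrite sqrrN expr1n.
  rewrite e /= => /(congr1 (fun t : pt R 2 => t.1 0 o0)); rewrite !mxE; lra.
exists 2%N, (fun i => match i with 0%N => [set @torus R 2]
  | 1%N => [set @torus R 2; H] | _ => @layers R 2 end).
split; first by exists (@torus R 2).
split=> //; split=> [[|[|//]] _|[|[|[|//]]] _].
- split; first by move=> _ ->; left.
  split.
    move=> e; have : [set @torus R 2; H] H by right.
    by rewrite -e => hT; case: TH => _; apply.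
  apply: (M_ideal_bottom (@layer_lexx R 2) (@layer_le_anti R 2)).
  by split=> [|_ [->|->] //]; [left|case: TH].
- split; first by move=> _ [->|->] //; case: bT.
  split.
    move=> e; move: Lp; rewrite -e => -[pE|pE].
      by case: (@point_minimal 1 H) => //; rewrite pE.
    by case: Hp => _; apply.
  apply: (M_ideal_atom (@layer_lexx R 2) (@layer_le_anti R 2) bT LH); first by case: TH.
  + move=> z Lz zH; have [->|[h zE]|[h [s _ [zE _]]]] := layer2_cases Lz; first by left.
      by right; move: zH; rewrite zE => /hyp_inj <-.
    have [->|zH'] := pselect (z = H); first by right.
    by case: (@point_minimal s H) => //; rewrite -zE.
  + move=> a [La [b [bb [ba amin]]]].
    have bE : b = @torus R 2.
      by apply: layer_le_anti; [exact: (proj2 bb) (proj1 bT)|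
        exact: (proj2 bT) (proj1 bb)].
    (* Every atom passes through (1, 1), as does [H], which provides a join there. *)
    subst b; suff a1 : a (pm 2 1).
      by eexists; apply: layer_mub La LH a1 _; exact: pm1_hyp.
    have [aT|[h ->]|[h [s s2 [aE hs]]]] := layer2_cases La.
    * by case: ba; rewrite aT.
    * exact: pm1_hyp.
    * have [||hT|<-] := amin _ (hyp_layer R h); [exact: (proj2 bT) (hyp_layer R h)| | |].
      - by rewrite aE => _ ->.
      - by case: (@torus_neq_hyp h).
      - exact: pm1_hyp.
  + move=> x [Lx xmax].
    have x1H : x (pm 2 1) -> x `<=` H.
      move=> x1; rewrite -(xmax _ Lp) => [_ ->|_ -> //]; exact: pm1_hyp.
    have [xT|[h xE]|[h [s s2 [xE _]]]] := layer2_cases Lx.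
    * by apply: x1H; rewrite xT; exact: pm_torus.
    * by apply: x1H; rewrite xE; exact: pm1_hyp.
    * by rewrite xE => _ ->; exact: pm_pair_hyp.
- exact: rank_of_set1.
- exact: (rank_of_set2 (@layer_le_anti R 2) bT).
- apply: (@rank_of_set_chain _ _ _ _ (fun i => match i with 0%N => @torus R 2
    | 1%N => H | _ => [set pm 2 1] end)).
    by split=> [[|[|[|//]]] _|[|[|//]] _] //; case: bT.
  exact: layer2_chain.
Qed.

End RankTwo.

Theorem theorem7p17 (R : realType) (l : nat) :
  (1 <= l)%N -> (supersolvable_BL R l <-> (l <= 2)%N).
Proof.
move=> l1; split=> [|l2].
  by move=> ss; rewrite leqNgt; apply/negP => l3; exact: not_supersolvable l3 ss.
case: l l1 l2 => [|[|[|l]]] // _ _; [exact: supersolvable_B1|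
  exact: supersolvable_B2].
Qed.
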